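(* Let $\xi$ be a Liouville number. Then for every integer $b\geq 2$ and every integer $k\geq 2$, the sequence of digits of the $b$-adic expansion of $\xi$ is not $k$-automatic. In other words, a Liouville number cannot be generated by a finite automaton.
   Context: An irrational real number $\xi$ is a Liouville number if for every $\tau>0$ the inequality $|\xi-p/q|<q^{-\tau}$ has at least one solution $(p,q)\in\mathbb{Z}^2$ with $q\geq 1$ (equivalently, its irrationality measure is infinite). For an integer $k\geq 2$, a sequence $(a_n)_{n\geq 0}$ with values in a finite set $\Delta$ is $k$-automatic if there exist a finite set of states $Q$, a transition function $\delta:Q\times\{0,\dots,k-1\}\to Q$, an initial state $q_0$ and an output map $\tau:Q\to\Delta$ such that $a_n=\tau(\delta(q_0,w_0w_1\cdots w_r))$ for all $n\geq 0$, where $n=\sum_{i=0}^r w_ik^i$ is the base-$k$ expansion of $n$ and $\delta$ is extended to words by $\delta(q,Ww)=\delta(\delta(q,W),w)$. A real number is generated by a finite automaton if for some integer $b\geq 2$ the digit sequence of its $b$-adic expansion is $k$-automatic for some $k\geq 2$.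
   Formalization: The definition of a Liouville number is taken with q ≥ 2 instead of q ≥ 1, since q = 1 would make every irrational number satisfy it and the claim false (e.g. for the Thue–Morse number); the corrected condition means exactly infinite irrationality measure. *)

(* Defs.v *)
From HB Require Import structures.
From mathcomp Require Import all_boot all_order all_algebra.
From mathcomp Require Import all_classical all_reals all_analysis.
Set Implicit Arguments.
Unset Strict Implicit.
Unset Printing Implicit Defensive.
Import Order.TTheory GRing.Theory Num.Theory.
Import numFieldNormedType.Exports.
Local Open Scope classical_set_scope.
Local Open Scope ring_scope.

(* The bound is 2 <= q: for q = 1 we have q `^ (- tau) = 1, so p = floor xi
   would make every irrational number satisfy the inequality. *)
Definition liouville (R : realType) (xi : R) : Prop :=
  irrational xi /\
  forall tau : R, 0 < tau ->
    exists p q : int,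
      2 <= q /\ `|xi - p%:~R / q%:~R| < q%:~R `^ (- tau).

(* The digits are those after the radix point, a 0 being the first one:
   xi = floor xi + \sum_(n >= 0) a n / b ^ (n + 1). *)
Definition badic_expansion (R : realType) (b : nat) (xi : R)
    (a : nat -> 'I_b) : Prop :=
  series (fun n => (a n)%:R / b%:R ^+ n.+1) @ \oo
    --> xi - (Num.floor xi)%:~R.

(* The word is w_0 w_1 ... w_r with n = \sum_i w_i k^i, least significant
   digit first; the integer 0 is represented by the one-letter word 0. *)
Definition base_expansion (k n r : nat) (w : r.+1.-tuple 'I_k) : Prop :=
  n = (\sum_(i < r.+1) tnth w i * k ^ i)%N /\
  ((0 < r)%N -> tnth w ord_max != 0%N :> nat).

Definition automatic (k : nat) (Delta : finType) (a : nat -> Delta) : Prop :=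
  exists (Q : finType) (delta : Q -> 'I_k -> Q) (q0 : Q) (tau : Q -> Delta),
    forall (n r : nat) (w : r.+1.-tuple 'I_k),
      base_expansion n w -> a n = tau (foldl delta q0 w).

Definition generated_by_automaton (R : realType) (xi : R) : Prop :=
  exists (b : nat) (a : nat -> 'I_b) (k : nat),
    [/\ (2 <= b)%N, (2 <= k)%N, badic_expansion xi a & automatic k a].

Lemma base_expansion_exists (k n : nat) : (2 <= k)%N ->
  exists (r : nat) (w : r.+1.-tuple 'I_k), base_expansion n w.
Proof.
move=> k2; have k0 : (0 < k)%N by exact: ltnW.
pose r := trunc_log k n.
exists r, [tuple Ordinal (ltn_pmod (n %/ k ^ i) k0) | i < r.+1]; split.
  under eq_bigr do rewrite tnth_mktuple /=.
  have H m : (\sum_(i < m) n %/ k ^ i %% k * k ^ i + n %/ k ^ m * k ^ m = n)%N.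
    elim: m => [|m IH]; first by rewrite big_ord0 expn0 divn1 muln1.
    rewrite big_ord_recr /= -[RHS]IH -addnA; congr (_ + _)%N.
    rewrite [in RHS](divn_eq (n %/ k ^ m) k) mulnDl addnC; congr (_ + _)%N.
    by rewrite -divnMA -expnSr -mulnA -expnS.
  by rewrite -[LHS](H r.+1) [(n %/ k ^ r.+1)%N]divn_small ?mul0n ?addn0 // trunc_log_ltn.
move=> r0; rewrite tnth_mktuple /=.
have n0 : (0 < n)%N by rewrite lt0n; apply: contraL r0 => /eqP n0; rewrite /r n0 trunc_log0.
rewrite modn_small; last by rewrite ltn_divLR ?expn_gt0 ?k0 // -expnS trunc_log_ltn.
by rewrite -lt0n divn_gt0 ?expn_gt0 ?k0 // trunc_logP.
Qed.

Lemma badic_expansion_exists (R : realType) (b : nat) (xi : R) : (2 <= b)%N ->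
  exists a : nat -> 'I_b, badic_expansion xi a.
Proof.
move=> b2; have b0 : (0 < b)%N by exact: ltnW.
have bR0 : 0 < b%:R :> R by rewrite ltr0n.
pose y := xi - (Num.floor xi)%:~R.
have y0 : 0 <= y by rewrite subr_ge0 floor_le.
have y1 : y < 1.
  by rewrite ltrBlDl; have /andP[_] := floor_itv xi; rewrite intrD.
pose f n := Num.truncn (b%:R ^+ n * y).
have fP n : (f n)%:R <= b%:R ^+ n * y < (f n).+1%:R.
  by apply: truncn_itv; rewrite mulr_ge0 // exprn_ge0 // ltW.
have fS n : (f n.+1 %/ b = f n)%N.
  have /andP[l1 u1] := fP n; have /andP[l2 u2] := fP n.+1.
  move: l2 u2; rewrite exprS -mulrA => l2 u2.
  apply/eqP; rewrite eqn_leq; apply/andP; split.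
    rewrite -ltnS ltn_divLR // -(ltr_nat R); apply: le_lt_trans l2 _.
    by rewrite natrM mulrC ltr_pM2r.
  rewrite leq_divRL // -ltnS -(ltr_nat R); apply: le_lt_trans u2.
  by rewrite natrM mulrC ler_pM2l.
exists (fun n => Ordinal (ltn_pmod (f n.+1) b0)).
have sE n : series (fun n => (f n.+1 %% b)%N%:R / b%:R ^+ n.+1) n
    = (f n)%:R / b%:R ^+ n :> R.
  elim: n => [|n IH].
    rewrite /series /= big_geq // expr0 divr1 /f expr0 mul1r.
    by rewrite (@truncn_def _ _ 0%N) //= y0.
  rewrite /series /= big_nat_recr //= -/(series _ n) [X in X + _]IH.
  rewrite [in RHS](divn_eq (f n.+1) b) fS natrD natrM mulrDl; congr (_ + _).
  by rewrite exprSr -mulf_div divff ?mulr1 // gt_eqF.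
rewrite /badic_expansion /= -/y.
have bV : `|b%:R^-1 : R| < 1.
  by rewrite ger0_norm ?invr_ge0 ?ler0n // invf_lt1 // ltr1n.
have bn0 n : 0 < b%:R ^+ n :> R by rewrite exprn_gt0.
apply: (@squeeze_cvgr _ _ _ _ (fun n => y - b%:R^-1 ^+ n) (cst y)).
- near=> n; rewrite sE; have /andP[l u] := fP n.
  rewrite ler_pdivrMr // [y * _]mulrC l andbT.
  rewrite ler_pdivlMr // mulrBl exprVn mulVf ?gt_eqF //.
  by rewrite lerBlDr [y * _]mulrC -[1]/(1%:R) -natrD addn1 ltW.
- rewrite -[X in _ --> X]subr0; apply: cvgB; first exact: cvg_cst.
  exact: cvg_expr.
- exact: cvg_cst.
Unshelve. all: by end_near.
Qed.

(* Main.v *)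
(* Reading the least significant digit first, the automaton shows that the
   blocks of length k^n of the digit sequence a take, uniformly in n, boundedly
   many shapes: for fixed r and s, block r + s coincides with block r at every
   level n. This yields approximations of x = xi - floor xi with denominators
   D = B^(r+s) - B^r, where B = b^(k^n), good enough that a rational p/q
   extremely close to x must, for the level n at which B is comparable to a
   power of q, coincide with one of them. Then the tails b^u x and b^v x, with
   u = (r + s) k^n and v = r k^n, nearly agree modulo 1, so that the digits
   after u and v agree for a very long time, or else, because of carries, a has
   a long run of zeros after their first mismatch. Finiteness of the kernel
   forbids both unless a is eventually periodic, i.e. xi rational. *)
Require Import Defs.
From mathcomp Require Import all_boot all_order all_algebra.
From mathcomp Require Import all_classical all_reals all_analysis.
From mathcomp Require Import zify ring lra.
Set Implicit Arguments.
Unset Strict Implicit.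
Unset Printing Implicit Defensive.
Import Order.TTheory GRing.Theory Num.Theory.
Import numFieldNormedType.Exports.

(** * Finiteness of the kernel of an automatic sequence *)

(** With [Q] finite, the [k]-kernel of [a] is finite up to initial terms. The value [m = 0] is left
    out: low digits followed by the word of [0] have a forbidden zero as top digit. *)
Definition kernel_presentation (k : nat) (A : Type) (a : nat -> A)
    (Q : Type) (f : Q -> nat -> A) : Prop :=
  forall n j : nat, (j < k ^ n)%N ->
    exists q : Q, forall m : nat, (0 < m)%N -> a (k ^ n * m + j)%N = f q m.

Definition eventually_periodic (A : Type) (a : nat -> A) : Prop :=
  exists u p : nat, (0 < p)%N /\ forall i, (u <= i)%N -> a (i + p)%N = a i.

Lemma base_expansion_cons (k n r : nat) (d : 'I_k) (w : r.+1.-tuple 'I_k) :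
  (0 < n)%N -> base_expansion n w -> base_expansion (d + k * n) [tuple of d :: w].
Proof.
move=> n0 [nE wtop]; split.
  rewrite big_ord_recl tnth0 expn0 muln1; congr (_ + _)%N.
  rewrite {1}nE big_distrr /=; apply: eq_bigr => i _.
  by rewrite tnthS expnS mulnCA.
move=> _; rewrite (_ : ord_max = lift ord0 ord_max); last exact: val_inj.
rewrite tnthS; case: r w nE wtop => [|r] w nE; last exact.
move: n0; rewrite nE big_ord_recl big_ord0 expn0 muln1 addn0 lt0n => + _.
by rewrite (_ : ord_max = ord0) //; exact: val_inj.
Qed.

(** [p] lists the [n] low digits of [j], zero-padded. It is the same for all [m], so the state
    reached after reading it depends only on [n] and [j]. *)
Lemma base_expansion_prefix (k n j : nat) : (j < k ^ n)%N ->
  exists p : seq 'I_k, forall m r (w : r.+1.-tuple 'I_k), (0 < m)%N ->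
    base_expansion m w ->
    exists r' (w' : r'.+1.-tuple 'I_k),
      base_expansion (k ^ n * m + j) w' /\ w' = p ++ w :> seq 'I_k.
Proof.
elim: n j => [|n IH] j jk.
  move: jk; rewrite expn0 ltnS leqn0 => /eqP ->; exists [::] => m r w m0 mw.
  by exists r, w; rewrite mul1n addn0.
have k0 : (0 < k)%N by move: jk; case: k {IH} => //; rewrite exp0n.
have [|p pP] := IH (j %/ k)%N; first by rewrite ltn_divLR // -expnSr.
exists (Ordinal (ltn_pmod j k0) :: p) => m r w m0 mw.
have [r' [w' [w'E w'p]]] := pP m r w m0 mw.
exists r'.+1, [tuple of Ordinal (ltn_pmod j k0) :: w']; split; last first.
  by rewrite /= w'p.
have -> : (k ^ n.+1 * m + j = Ordinal (ltn_pmod j k0) + k * (k ^ n * m + j %/ k))%N.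
  rewrite /= {1}(divn_eq j k) expnS; lia.
by apply: base_expansion_cons => //; rewrite addn_gt0 muln_gt0 expn_gt0 k0 m0.
Qed.

Lemma automatic_kernel (k : nat) (A : finType) (a : nat -> A) :
  (2 <= k)%N -> automatic k a ->
  exists (Q : finType) (f : Q -> nat -> A), kernel_presentation k a f.
Proof.
move=> k2 [Q [delta [q0 [tau aE]]]].
have /boolp.choice[word wordP] : forall m, exists s : seq 'I_k,
    exists r (w : r.+1.-tuple 'I_k), base_expansion m w /\ s = w.
  by move=> m; have [r [w mw]] := base_expansion_exists m k2; exists w, r, w.
exists Q, (fun q m => tau (foldl delta q (word m))) => n j jk.
have [p pP] := base_expansion_prefix jk.
exists (foldl delta q0 p) => m m0.
have [r [w [mw ->]]] := wordP m.
have [r' [w' [/aE -> ->]]] := pP _ _ _ m0 mw.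
by rewrite foldl_cat.
Qed.

Lemma kernel_repetition (k : nat) (A Q : finType) (a : nat -> A)
    (f : Q -> nat -> A) : kernel_presentation k a f ->
  exists r s : nat, [/\ (0 < r)%N, (0 < s)%N &
    forall n j, (j < k ^ n)%N -> a (k ^ n * (r + s) + j)%N = a (k ^ n * r + j)%N].
Proof.
move=> fP.
(* Pigeonhole on the maps sending [q] to [f q m]; the shift to [i.+1] keeps the argument [m]
   positive. *)
pose g (i : 'I_(#|{ffun Q -> A}|.+1)) := [ffun q => f q i.+1].
have /injectivePn[i [j ij gij]] : ~~ injectiveb g.
  by apply/injectiveP => /leq_card; rewrite card_ord ltnn.
wlog ltij : i j ij gij / (i < j)%N.
  move=> W; case: (ltngtP i j) => [|ji|/val_inj ijE]; first exact: W.
    by apply: (W j i); rewrite 1?eq_sym.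
  by rewrite ijE eqxx in ij.
exists i.+1, (j - i)%N; split; rewrite ?subn_gt0 // => n l lk.
have [q qP] := fP n l lk; rewrite addSn subnKC ?(ltnW ltij) // !qP //.
by have /ffunP/(_ q) := gij; rewrite !ffunE.
Qed.

(* A kernel sequence that is not s-periodic from r on fails to be so at a fixed
   place; as the kernel is finite, these places are bounded by some L, so
   s k^n-periodicity of a up to L k^n propagates to all of a. *)
Lemma kernel_aperiodicity (k : nat) (A : eqType) (Q : finType) (a : nat -> A)
    (f : Q -> nat -> A) : (0 < k)%N -> kernel_presentation k a f ->
  ~ eventually_periodic a ->
  forall r s : nat, (0 < r)%N -> (0 < s)%N ->
  exists L : nat, forall n, exists i,
    [/\ (k ^ n * r <= i)%N, (i + k ^ n * s < k ^ n * L)%N &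
        a (i + k ^ n * s)%N != a i].
Proof.
move=> k0 fP aper r s r0 s0.
have /boolp.choice[M MP] q : exists M,
    (exists m, [/\ (r <= m)%N, (m < M)%N & f q (m + s)%N != f q m]) \/
    (forall m, (r <= m)%N -> f q (m + s)%N = f q m).
  have [E|E] := boolp.pselect (forall m, (r <= m)%N -> f q (m + s)%N = f q m).
    by exists 0%N; right.
  move/boolp.existsNP: E => [m /boolp.not_implyP[rm /eqP fm]].
  by exists m.+1; left; exists m.
(* [M q] bounds a failure of [s]-periodicity; [+ s] makes room for the shifted place. *)
pose L := (\max_q M q + s)%N; exists L => n.
apply: boolp.contrapT => noi; apply: aper; exists (k ^ n * r)%N, (k ^ n * s)%N.
have kn0 : (0 < k ^ n)%N by rewrite expn_gt0 k0.
split; first by rewrite muln_gt0 kn0.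
move=> i ri; have jk := ltn_pmod i kn0.
have [q qP] := fP _ _ jk.
have iE : i = (k ^ n * (i %/ k ^ n) + i %% k ^ n)%N by rewrite mulnC -divn_eq.
have rd : (r <= i %/ k ^ n)%N by rewrite leq_divRL // mulnC.
rewrite iE addnAC -mulnDr !qP ?addn_gt0 ?(leq_trans r0 rd) //.
case: (MP q) => [[m [rm mM /negP fm]]|]; last exact.
case: fm; apply/negP => fm; apply: noi.
exists (k ^ n * m + i %% k ^ n)%N; split.
- by apply: (leq_trans _ (leq_addr _ _)); rewrite leq_mul2l rm orbT.
- rewrite addnAC -mulnDr /L.
  have mL : (m + s).+1 <= \max_q M q + s.
    by rewrite -addSn leq_add2r; apply: leq_trans mM (leq_bigmax q).
  apply: (@leq_trans (k ^ n * (m + s).+1)); last by rewrite leq_mul2l mL orbT.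
  by rewrite mulnS addnC ltn_add2r.
- by rewrite addnAC -mulnDr !qP ?addn_gt0 ?(leq_trans r0 rm) //; apply/negP.
Qed.

Local Open Scope ring_scope.

(** * Tails of an expansion: agreement and carries *)

Fixpoint digit_prefix (b : nat) (a : nat -> 'I_b) (i : nat) : nat :=
  if i is i'.+1 then (b * digit_prefix a i' + a i')%N else 0%N.

(** When [a] expands [x], this is the fractional part of [b ^ i * x], or [1] if all later digits are
    [b - 1]. *)
Definition tail (R : realType) (b : nat) (a : nat -> 'I_b) (x : R) (i : nat) : R :=
  b%:R ^+ i * x - (digit_prefix a i)%:R.

Lemma tailS (R : realType) (b : nat) (a : nat -> 'I_b) (x : R) (i : nat) :
  tail a x i.+1 = b%:R * tail a x i - (a i)%:R.
Proof. by rewrite /tail /= natrD natrM exprS; ring. Qed.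

Lemma series_digit_prefix (R : realType) (b : nat) (a : nat -> 'I_b) (n : nat) :
  (0 < b)%N ->
  series (fun n => (a n)%:R / b%:R ^+ n.+1) n =
    (digit_prefix a n)%:R / b%:R ^+ n :> R.
Proof.
move=> b0; elim: n => [|n IH]; first by rewrite /series /= big_geq // mul0r.
rewrite /series /= big_nat_recr //= -/(series _ n) [X in X + _]IH.
rewrite natrD natrM mulrDl exprS; congr (_ + _).
by rewrite -mulf_div divff ?mul1r // pnatr_eq0 -lt0n.
Qed.

(** The partial sums [s n] increase and [s n + b ^ (- n)] decrease, so they enclose [x]. *)
Lemma tail_itv (R : realType) (b : nat) (a : nat -> 'I_b) (xi : R) (i : nat) :
  badic_expansion xi a -> 0 <= tail a (xi - (Num.floor xi)%:~R) i <= 1.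
Proof.
rewrite /badic_expansion; set x := xi - _; set s := series _ => sx.
have b0 : (0 < b)%N by apply: leq_ltn_trans (ltn_ord (a 0%N)).
have bn0 n : 0 < b%:R ^+ n :> R by rewrite exprn_gt0 // ltr0n.
have sE n : s n = (digit_prefix a n)%:R / b%:R ^+ n by exact: series_digit_prefix.
have sS n : s n.+1 = s n + (a n)%:R / b%:R ^+ n.+1.
  by rewrite /s /series /= big_nat_recr.
have s_nondec : nondecreasing_seq s.
  by apply/nondecreasing_seqP => n; rewrite sS lerDl divr_ge0 // ltW.
have le1 : s i <= x.
  rewrite -(cvg_lim _ sx) //; apply: nondecreasing_cvgn_le => //.
  by apply/cvg_ex; exists x.
have le2 : x <= s i + (b%:R ^+ i)^-1.
  have bnd n : s (i + n)%N + (b%:R ^+ (i + n))^-1 <= s i + (b%:R ^+ i)^-1.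
    elim: n => [|n IH]; first by rewrite addn0.
    apply: le_trans IH; rewrite addnS sS -addrA lerD2l.
    rewrite -[X in _ + X]mul1r -mulrDl ler_pdivrMr // exprSr mulrA mulVf ?gt_eqF //.
    by rewrite mul1r -[1]/(1%:R) -natrD ler_nat addn1.
  rewrite -(cvg_lim _ sx) //; apply: limr_le; first by apply/cvg_ex; exists x.
  near=> n; have ni : (i <= n)%N by near: n; exact: nbhs_infty_ge.
  rewrite -(subnKC ni); apply: (le_trans _ (bnd (n - i)%N)).
  by rewrite lerDl invr_ge0 ltW.
move: le1 le2; rewrite /tail sE -[X in _ + X]mul1r -mulrDl.
rewrite ler_pdivrMr // ler_pdivlMr // mulrC => le1 le2.
by rewrite subr_ge0 le1 /= lerBlDl.
Unshelve. all: by end_near.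
Qed.

Section Tails.
Context (R : realType) (b : nat) (a : nat -> 'I_b) (x : R).
Hypothesis b2 : (2 <= b)%N.
Hypothesis tail01 : forall i, 0 <= tail a x i <= 1.

Let b0 : 0 < b%:R :> R. Proof. by rewrite ltr0n ltnW. Qed.

(** Equal digits cancel in [tailS], so each one multiplies the gap between the tails by [b], while
    this gap never exceeds 1. *)
Lemma tail_agree (l u v : nat) :
  (forall j, (j < l)%N -> a (u + j)%N = a (v + j)%N) ->
  `|tail a x u - tail a x v| * b%:R ^+ l <= 1.
Proof.
elim: l u v => [|l IH] u v agree.
  rewrite expr0 mulr1 ler_norml; have := tail01 u; have := tail01 v; lra.
have auv : a u = a v by have /(_ erefl) := agree 0%N; rewrite !addn0.
have /IH : forall j, (j < l)%N -> a (u.+1 + j)%N = a (v.+1 + j)%N.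
  by move=> j jl; rewrite !addSnnS; apply: agree.
rewrite !tailS auv opprB addrA subrK -mulrBr normrM gtr0_norm //.
by rewrite exprS mulrCA mulrA.
Qed.

(** Periodicity makes two tails equal, which is a nontrivial linear equation for [x] with integer
    coefficients. *)
Lemma tail_eventually_periodic : irrational x -> ~ eventually_periodic a.
Proof.
move=> irr [u [p [p0 per]]]; apply: irr.
have eq_tail : tail a x (u + p) = tail a x u.
  apply/eqP; rewrite -subr_eq0; apply/eqP/normr0_eq0/eqP.
  set d := tail a x (u + p) - tail a x u.
  apply: contraT; rewrite -normr_gt0 normr_id => d0; pose n := Num.bound `|d|^-1.
  have : `|d| * b%:R ^+ n <= 1.
    by apply: tail_agree => j _; rewrite addnAC per ?leq_addr.
  rewrite mulrC -ler_pdivlMr // div1r leNgt => /negP[].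
  apply: (lt_trans (archi_boundP _)); first by rewrite invr_ge0.
  by rewrite -natrX ltr_nat ltn_expl.
have bup : b%:R ^+ (u + p) - b%:R ^+ u != 0 :> R.
  rewrite subr_eq0 -!natrX eqr_nat eqn_exp2l //; lia.
exists (((digit_prefix a (u + p))%:R - (digit_prefix a u)%:R)
          / (b%:R ^+ (u + p) - b%:R ^+ u)) => //.
rewrite fmorph_div !rmorphB !rmorphXn !rmorph_nat /=.
apply: (mulIf bup); rewrite divfK //; move: eq_tail; rewrite /tail; lra.
Qed.

(* The integer P is the carry in comparing the two expansions: it is multiplied
   by b at each step and corrected by a digit difference, so it can remain
   bounded only if these differences stay extremal. *)
Lemma tail_carry (l u v : nat) (P : int) :
  1 <= P -> `|tail a x u - tail a x v - P%:~R| * b%:R ^+ l < 1 ->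
  forall j, (j < l)%N -> a (v + j)%N = 0%N :> nat.
Proof.
elim: l u v P => // l IH u v P P1 near.
pose P' : int := b%:Z * P - (a u)%:Z + (a v)%:Z.
have near' : `|tail a x u.+1 - tail a x v.+1 - P'%:~R| * b%:R ^+ l < 1.
  move: near; rewrite exprS mulrA -[X in _ * X * _](gtr0_norm b0) -normrM.
  congr (`|_| * _ < 1); rewrite !tailS /P' intrD intrB intrM -!pmulrn; ring.
have P'1 : 1 <= P' by have := ltn_ord (a u); rewrite /P'; nia.
have P'2 : P' < 2.
  rewrite -(ltr_int R).
  have : `|tail a x u.+1 - tail a x v.+1 - P'%:~R| < 1.
    apply: le_lt_trans near'; rewrite ler_peMr // exprn_ege1 // ler1n ltnW //.
  rewrite ltr_norml; have := tail01 u.+1; have := tail01 v.+1; lra.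
move=> [_|j jl]; last by rewrite -addSnnS; apply: IH P'1 near' _ jl.
(* [P' = 1], [P >= 1] and [a u <= b - 1] force [a v = 0]. *)
by rewrite addn0; have := ltn_ord (a u); move: P'2; rewrite /P'; nia.
Qed.

(** The first mismatch, at or before [i], creates a nonzero carry whose sign tells which side
    continues with zeros. *)
Lemma tail_mismatch (l u v i : nat) :
  `|tail a x u - tail a x v| * b%:R ^+ l < 1 ->
  a (u + i)%N != a (v + i)%N ->
  (forall j, (i < j < l)%N -> a (u + j)%N = 0%N :> nat) \/
  (forall j, (i < j < l)%N -> a (v + j)%N = 0%N :> nat).
Proof.
elim: l u v i => [|l IH] u v i near neq; first by left=> j; rewrite ltn0 andbF.
have [auv|auv] := eqVneq (a u) (a v).
  case: i neq => [|i] neq; first by rewrite !addn0 auv eqxx in neq.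
  have near' : `|tail a x u.+1 - tail a x v.+1| * b%:R ^+ l < 1.
    move: near; rewrite exprS mulrA -[X in _ * X * _](gtr0_norm b0) -normrM.
    congr (`|_| * _ < 1); rewrite !tailS auv; ring.
  have := IH _ _ i near'; rewrite !addSnnS => /(_ neq).
  by case=> zero; [left|right] => -[|j] // jl; rewrite -addSnnS; apply: zero.
pose P' : int := (a v)%:Z - (a u)%:Z.
have near' : `|tail a x u.+1 - tail a x v.+1 - P'%:~R| * b%:R ^+ l < 1.
  move: near; rewrite exprS mulrA -[X in _ * X * _](gtr0_norm b0) -normrM.
  congr (`|_| * _ < 1); rewrite !tailS /P' intrB -!pmulrn; ring.
have [P1|P1] : 1 <= P' \/ 1 <= - P'.
  by move: auv; rewrite /P' -val_eqE /=; lia.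
  right=> -[|j] // /andP[_ jl]; rewrite -addSnnS; exact: tail_carry P1 near' _ _.
left=> -[|j] // /andP[_ jl]; rewrite -addSnnS.
apply: (@tail_carry l v.+1 u.+1 _ P1 _ j jl); rewrite mulrNz opprK.
by move: near'; rewrite -normrN; congr (`|_| * _ < 1); ring.
Qed.
End Tails.

(** * Choice of scale and Diophantine estimates *)

(** For the least [n], the previous level is below [2 * q <= q ^ 2], and taking [k]-th powers gives
    the bound; the summand [b] covers [n = 0]. *)
Lemma double_exp_scale (b k q : nat) : (2 <= b)%N -> (2 <= k)%N -> (2 <= q)%N ->
  exists n : nat,
    (2 * q <= b ^ (k ^ n))%N /\ (b ^ (k ^ n) <= q ^ (b + 2 * k))%N.
Proof.
move=> b2 k2 q2.
have ex : exists n, (2 * q <= b ^ (k ^ n))%N.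
  exists (2 * q)%N; apply: leq_trans (ltnW (ltn_expl _ b2)).
  exact: (ltnW (ltn_expl _ k2)).
case: (ex_minnP ex) => n qn min_n; exists n; split => //.
case: n qn min_n => [|n] qn min_n.
  rewrite expn0 expn1; apply: leq_trans (ltnW (ltn_expl b q2)) _.
  by rewrite leq_exp2l // leq_addr.
have lt : (b ^ (k ^ n) <= q ^ 2)%N.
  apply: (@leq_trans (2 * q)); last by rewrite leq_mul2r q2 orbT.
  by rewrite leqNgt; apply/negP => /ltnW /min_n; rewrite ltnn.
rewrite expnSr expnM; apply: (@leq_trans (q ^ (2 * k))).
  by rewrite expnM leq_exp2r // ltnW.
by rewrite leq_exp2l // leq_addl.
Qed.

Lemma liouville_nat (R : realType) (xi : R) (T : nat) : liouville xi -> (0 < T)%N ->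
  exists (p : int) (q : nat), (2 <= q)%N /\ `|xi - p%:~R / q%:R| * q%:R ^+ T < 1.
Proof.
move=> [_ /(_ T%:R)]; rewrite ltr0n => /[apply] -[p [q [q2 close]]].
exists p, `|q|%N; split; first lia.
have qE : q%:~R = `|q|%N%:R :> R by rewrite pmulrn gez0_abs //; lia.
move: close; rewrite qE powRN powR_mulrn // -[X in _ < X]div1r ltr_pdivlMr //.
by rewrite exprn_gt0 // ltr0n; lia.
Qed.

(* Integrality: D x is within 1/B of the integer P, and p/q is a far better
   approximation, so D p - q P is an integer of absolute value < 1. *)
Lemma close_approximation (R : realType) (x D B : R) (P p d : int) (q s N : nat) :
  (0 < q)%N -> 0 < B -> 2 * q%:R <= B -> 0 < D <= B ^+ s -> D = d%:~R ->
  `|D * x - P%:~R| * B <= 1 ->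
  `|q%:R * x - p%:~R| * B ^+ (s + N).+1 < q%:R ->
  `|D * x - P%:~R| * B ^+ N.+1 < 1.
Proof.
move=> q0 B0 qB /andP[D0 DB] dE PB pB.
have qR : 0 < q%:R :> R by rewrite ltr0n.
have q1 : 1 <= q%:R :> R by rewrite ler1n.
have B1 : 1 <= B by lra.
have pD : D * `|q%:R * x - p%:~R| * B ^+ N.+1 < q%:R.
  apply: le_lt_trans pB; rewrite -addnS exprD mulrA ler_pM2r ?exprn_gt0 //.
  by rewrite mulrC; apply: ler_wpM2l.
have zE : (d * p - q%:Z * P)%:~R =
    q%:R * (D * x - P%:~R) - D * (q%:R * x - p%:~R).
  by rewrite intrB !intrM -dE -pmulrn; ring.
have z0 : d * p - q%:Z * P = 0.
  apply/eqP; rewrite -normr_le0 -ltzD1 add0r -(ltr_int R) intr_norm zE.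
  apply: le_lt_trans (ler_normB _ _) _.
  rewrite !normrM [`|D|]gtr0_norm // [`|q%:R|]gtr0_norm //.
  (* By [2 * q <= B] both error terms are at most 1/2, the second one strictly less. *)
  have h1 : q%:R * `|D * x - P%:~R| * 2 <= 1.
    apply: le_trans PB; rewrite mulrAC [leRHS]mulrC.
    by apply: ler_wpM2r => //; rewrite mulrC.
  have h2 : D * `|q%:R * x - p%:~R| * 2 < 1.
    rewrite -(ltr_pM2r qR) mul1r -[ltLHS]mulrA; apply: le_lt_trans pD.
    apply: ler_wpM2l; first by rewrite mulr_ge0 // ltW.
    by apply: le_trans qB _; rewrite exprS ler_peMr ?exprn_ege1 // ltW.
  lra.
move: zE; rewrite z0 => /eqP; rewrite eq_sym subr_eq0 => /eqP zE.
rewrite -(ltr_pM2l qR) mulr1 mulrA -[X in X * _ * _](gtr0_norm qR) -normrM zE.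
by rewrite normrM gtr0_norm.
Qed.

(** * Contradiction for an automatic Liouville number *)

Lemma liouville_not_automatic (R : realType) (xi : R) (b k : nat) (a : nat -> 'I_b) :
  liouville xi -> (2 <= b)%N -> (2 <= k)%N -> badic_expansion xi a ->
  ~ automatic k a.
Proof.
move=> hxi b2 k2 axi /(automatic_kernel k2)[Q [f fP]].
have k0 : (0 < k)%N by exact: ltnW.
set x := xi - (Num.floor xi)%:~R.
have x01 i : 0 <= tail a x i <= 1 by exact: tail_itv.
have aper : ~ eventually_periodic a.
  apply: (tail_eventually_periodic b2 x01) => -[y _ yx]; case: hxi => + _; apply.
  by exists (y + (Num.floor xi)%:~R) => //; rewrite rmorphD /= ratr_int yx subrK.
have [r [s [r0 s0 rep]]] := kernel_repetition fP.
have [L LP] := kernel_aperiodicity k0 fP aper r0 s0.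
(* Aperiodicity with period factor [1] gives two distinct digits [k ^ n] apart, so [a] is not all
   zero between [k ^ n * (r + s + L)] and [k ^ n * M]. *)
have [M MP] : exists M : nat, forall n, exists i,
    [/\ (k ^ n * (r + s + L) <= i)%N, (i + k ^ n * 1 < k ^ n * M)%N &
        a (i + k ^ n * 1)%N != a i].
  by apply: (kernel_aperiodicity k0 fP aper); rewrite ?addn_gt0 ?r0.
(* As [B <= q ^ (b + 2 * k)], [q ^ T] will dominate [B ^ (r + s + M).+1]. [T] can be fixed before
   [q] because [r], [s] and [M] are uniform in the level [n]. *)
pose T := ((b + 2 * k) * (r + s + M).+1).+1.
have [p [q [q2 pq]]] := liouville_nat (T := T) hxi isT.
have [n [qB Bq]] := double_exp_scale b2 k2 q2.
pose K := (k ^ n)%N; pose B : R := b%:R ^+ K.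
have bR : 0 < b%:R :> R by rewrite ltr0n ltnW.
have B0 : 0 < B by rewrite exprn_gt0.
have qR : 0 < q%:R :> R by rewrite ltr0n ltnW.
pose u := (K * (r + s))%N; pose v := (K * r)%N.
have near : `|tail a x u - tail a x v| * b%:R ^+ (K * M.+1) < 1.
  have tuv : tail a x u - tail a x v = (b%:R ^+ u - b%:R ^+ v) * x
      - ((digit_prefix a u)%:Z - (digit_prefix a v)%:Z)%:~R.
    by rewrite /tail intrB -!pmulrn; ring.
  rewrite exprM tuv.
  (* Subtracting the floor turns [p / q] into an approximation of [x]. *)
  apply: (@close_approximation _ _ _ _ _ (p - Num.floor xi * q%:Z)
    ((b ^ u)%:Z - (b ^ v)%:Z) q (r + s)) => //.
  - exact: ltnW.
  - by rewrite -natrX -natrM ler_nat.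
  - rewrite /B -exprM; apply/andP; split.
      rewrite subr_gt0 ltr_eXn2l ?ltr1n // /u /v mulnDr -[X in (X < _)%N]addn0.
      by rewrite ltn_add2l muln_gt0 expn_gt0 k0.
    by rewrite gerBl exprn_ge0 // ltW.
  - by rewrite intrB -!pmulrn !natrX.
  - rewrite -tuv; apply: tail_agree => // j jK.
    exact: rep.
  - have -> : q%:R * x - (p - Num.floor xi * q%:Z)%:~R = q%:R * (xi - p%:~R / q%:R).
      rewrite /x intrB intrM -pmulrn [RHS]mulrBr [X in _ = _ - X]mulrC.
      by rewrite divfK ?gt_eqF //; ring.
    rewrite normrM gtr0_norm // -mulrA -[ltRHS]mulr1 ltr_pM2l //.
    apply: le_lt_trans pq; apply: ler_wpM2l => //.
    rewrite -natrX -natrX -natrX ler_nat /T (expnS q).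
    apply: (@leq_trans (q ^ ((b + 2 * k) * (r + s + M).+1))).
      by rewrite [leqRHS]expnM leq_exp2r.
    by rewrite leq_pmull // ltnW.
have [i [vi iL neq]] := LP n.
have uE : u = (v + K * s)%N by rewrite /u /v mulnDr.
(* Both mismatched places lie below [K * L], so either run of zeros from [tail_mismatch] covers this
   range. *)
have zero j : (K * (r + s + L) <= j)%N -> (j < K * M)%N -> a j = 0%N :> nat.
  move=> lj jM.
  have [] := tail_mismatch b2 x01 near (i := (i - v)%N).
  - by rewrite uE addnAC !subnKC.
  - move=> /(_ (j - u)%N); rewrite subnKC; last by rewrite /u; nia.
    by apply; rewrite /u /v; nia.
  - move=> /(_ (j - v)%N); rewrite subnKC; last by rewrite /v; nia.
    by apply; rewrite /u /v; nia.
have [j [lj jM /eqP]] := MP n; apply; apply: val_inj.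
by rewrite /= !zero //; rewrite -/K in lj jM *; lia.
Qed.

Theorem theorem1 (R : realType) (xi : R) (hxi : liouville xi) :
  (forall b k : nat, (2 <= b)%N -> (2 <= k)%N ->
     forall a : nat -> 'I_b, badic_expansion xi a -> ~ automatic k a) /\
  ~ generated_by_automaton xi.
Proof.
split=> [b k b2 k2 a|[b [a [k [b2 k2 axi]]]]].
  exact: liouville_not_automatic.
exact: liouville_not_automatic axi.
Qed.
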